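(* Let $n,m\ge 1$ be integers and let $P$ be an image with $n$ columns and $m$ rows, with pixel points $P_{ij}$, $(i,j)\in\Omega=\{1,\dots,n\}\times\{1,\dots,m\}$. Let $(i_1,j_1),(i_2,j_2)\in\Omega$ be any two positions, and let $P^*$ be the transformed image obtained from $P$ by swapping the positions of the two pixel points $P_{i_1j_1}$ and $P_{i_2j_2}$ and leaving all other pixel points in place; that is, the position map is $(i_1,j_1)'=(i_2,j_2)$, $(i_2,j_2)'=(i_1,j_1)$, and $(i,j)'=(i,j)$ for every other $(i,j)\in\Omega$. Then the total information content of the image decreases or remains unchanged: $$M(P^* )\le M(P),$$ where $M(P)$ and $M(P^* )$ denote the information content of the original image and of the transformed image, as defined in the context.
   Context: Image. An image $P$ with $n$ columns and $m$ rows consists of pixel points $P_{ij}$ located at coordinates $(i,j)\in\Omega=\{1,\dots,n\}\times\{1,\dots,m\}$, each carrying a pixel value. Distances. Put $d_{max}=\sqrt{m^2+n^2}$ and, for $(i,j),(s,t)\in\Omega$, $$d(P_{ij},P_{st})=\sqrt{(i-s)^2+(j-t)^2},\qquad \tilde d(P_{ij},P_{st})=\frac{d(P_{ij},P_{st})}{d_{max}}.$$ Information between two pixel points (depends only on their positions): $$m_{neig}(P_{ij},P_{st})=1-\frac{1}{1+e^{6-18\tilde d(P_{ij},P_{st})}}.$$ Information content of the original image: $$M_{neig}(P_{ij})=\sum_{(s,t)\in\Omega} m_{neig}(P_{ij},P_{st}),\qquad M_P(P_{ij})=M_{pix}(P_{ij})+M_{neig}(P_{ij}),\qquad M(P)=\sum_{(i,j)\in\Omega}M_P(P_{ij}).$$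 Here $M_{pix}(P_{ij})$ is a real number, the pixel-value information of the pixel point. It is an arbitrary but fixed function of the pixel value only, so it is unchanged when the pixel point is moved to another position. Information content after a transformation of positions. Suppose the pixel points are moved by a bijection of $\Omega$, written $(i,j)\mapsto(i',j')=(i,j)'$, so that the pixel point originally at $(i,j)$ is now at $(i',j')$; denote the moved pixel point by $P^*_{ij}$ and the transformed image by $P^*$. The information between two moved pixel points is $$m^*_{neig}(P_{i'j'},P_{s't'})=\bigl[1-\bigl(m_{neig}(P_{ij},P_{st})-m_{neig}(P_{i'j'},P_{s't'})\bigr)\bigr]\cdot m_{neig}(P_{ij},P_{st}),$$ where $m_{neig}(P_{i'j'},P_{s't'})$ is computed by the formula above from the new positions $(i',j')$ and $(s',t')$. The information content of the transformed image is $$M_{neig}(P^*_{ij})=\sum_{(s,t)\in\Omega}m^*_{neig}(P_{i'j'},P_{s't'}),\qquad M(P^* )=\sum_{(i,j)\in\Omega}\bigl(M_{pix}(P^*_{ij})+M_{neig}(P^*_{ij})\bigr),$$ with $M_{pix}(P^*_{ij})=M_{pix}(P_{ij})$. *)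

(* Defs.v *)
From HB Require Import structures.
From mathcomp Require Import all_boot all_order all_fingroup all_algebra.
From mathcomp Require Import reals sequences exp.

Set Implicit Arguments.
Unset Strict Implicit.
Unset Printing Implicit Defensive.

Import Order.TTheory GRing.Theory Num.Theory.
Local Open Scope ring_scope.

(* The set Omega = {1..n} x {1..m}; the ordinal i stands for coordinate i + 1. *)
Definition position (n m : nat) : finType := ('I_n * 'I_m)%type.

Definition coordx (R : realType) (n m : nat) (p : position n m) : R :=
  (nat_of_ord p.1).+1%:R.

Definition coordy (R : realType) (n m : nat) (p : position n m) : R :=
  (nat_of_ord p.2).+1%:R.

(* V is the type of pixel values; P p is the value of the pixel point of the
   image P located at p. *)
Definition pixel_image (V : Type) (n m : nat) : Type := position n m -> V.

Definition d_max (R : realType) (n m : nat) : R :=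
  Num.sqrt (m%:R ^+ 2 + n%:R ^+ 2).

Definition dist (R : realType) (n m : nat) (p q : position n m) : R :=
  Num.sqrt ((coordx R p - coordx R q) ^+ 2 + (coordy R p - coordy R q) ^+ 2).

Definition rel_dist (R : realType) (n m : nat) (p q : position n m) : R :=
  dist R p q / d_max R n m.

Definition m_neig (R : realType) (n m : nat) (p q : position n m) : R :=
  1 - 1 / (1 + expR (6 - 18 * rel_dist R p q)).

Definition M_neig (R : realType) (n m : nat) (p : position n m) : R :=
  \sum_(q : position n m) m_neig R p q.

(* phi gives the information of a pixel value. *)
Definition M_pix (R : realType) (V : Type) (phi : V -> R) (n m : nat)
    (P : pixel_image V n m) (p : position n m) : R :=
  phi (P p).

Definition M_point (R : realType) (V : Type) (phi : V -> R) (n m : nat)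
    (P : pixel_image V n m) (p : position n m) : R :=
  M_pix phi P p + M_neig R p.

Definition M_total (R : realType) (V : Type) (phi : V -> R) (n m : nat)
    (P : pixel_image V n m) : R :=
  \sum_(p : position n m) M_point phi P p.

(* The pixel point originally at p is moved to s p, so the one found at q
   after the transformation comes from s^-1 q. *)
Definition transform (V : Type) (n m : nat) (s : {perm position n m})
    (P : pixel_image V n m) : pixel_image V n m :=
  fun q => P ((s^-1)%g q).

(* In the starred quantities p and q are the original positions. *)
Definition m_neig_star (R : realType) (n m : nat) (s : {perm position n m})
    (p q : position n m) : R :=
  (1 - (m_neig R p q - m_neig R (s p) (s q))) * m_neig R p q.

Definition M_neig_star (R : realType) (n m : nat) (s : {perm position n m})
    (p : position n m) : R :=
  \sum_(q : position n m) m_neig_star R s p q.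

Definition M_pix_star (R : realType) (V : Type) (phi : V -> R) (n m : nat)
    (s : {perm position n m}) (P : pixel_image V n m) (p : position n m) : R :=
  M_pix phi (transform s P) (s p).

Definition M_total_star (R : realType) (V : Type) (phi : V -> R) (n m : nat)
    (s : {perm position n m}) (P : pixel_image V n m) : R :=
  \sum_(p : position n m) (M_pix_star phi s P p + M_neig_star R s p).

Lemma M_pix_starE (R : realType) (V : Type) (phi : V -> R) (n m : nat)
    (s : {perm position n m}) (P : pixel_image V n m) (p : position n m) :
  M_pix_star phi s P p = M_pix phi P p.
Proof. by rewrite /M_pix_star /M_pix /transform permK. Qed.

(* Main.v *)
Require Import Defs.
From HB Require Import structures.
From mathcomp Require Import all_boot all_order all_fingroup all_algebra.
From mathcomp Require Import reals sequences exp.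
From mathcomp Require Import lra.

(** Since (1 - (a - b)) a - a = a b - a^2, the change of information content is
    the sum over pairs of a b - a^2, where a and b are the information of the
    pair before and after the move. By a b <= (a^2 + b^2) / 2 it is at most half
    of sum b^2 - sum a^2, which vanishes because the move permutes the pairs.
    So the inequality holds for every permutation of the positions. *)

Set Implicit Arguments.
Unset Strict Implicit.
Unset Printing Implicit Defensive.

Import Order.TTheory GRing.Theory Num.Theory.
Local Open Scope ring_scope.

(** An instance of Cauchy-Schwarz: [f] and its rearrangement by [s] have the same sum of squares. *)
Lemma sum_mul_perm_le_sum_sqr (R : realFieldType) (T : finType)
    (f : T -> T -> R) (s : {perm T}) :
  \sum_p \sum_q f p q * f (s p) (s q) <= \sum_p \sum_q f p q ^+ 2.
Proof.
have sum_perm : \sum_p \sum_q f (s p) (s q) ^+ 2 = \sum_p \sum_q f p q ^+ 2.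
  rewrite [RHS](reindex_inj (@perm_inj _ s)); apply: eq_bigr => p _.
  by rewrite [RHS](reindex_inj (@perm_inj _ s)).
have : \sum_p \sum_q (f p q * f (s p) (s q)) *+ 2 <=
       \sum_p \sum_q (f p q ^+ 2 + f (s p) (s q) ^+ 2).
  (* Termwise, the right side minus the left is [(f p q - f (s p) (s q)) ^+ 2]. *)
  by do 2![apply: ler_sum => ? _]; rewrite -subr_ge0 addrAC -sqrrB sqr_ge0.
under eq_bigr do rewrite sumrMnl.
under [leRHS]eq_bigr do rewrite big_split.
by rewrite sumrMnl big_split /= sum_perm; lra.
Qed.

Lemma M_total_star_le (R : realType) (V : Type) (phi : V -> R) (n m : nat)
    (s : {perm position n m}) (P : pixel_image V n m) :
  M_total_star phi s P <= M_total phi P.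
Proof.
rewrite /M_total_star /M_total /M_point !big_split /=.
under eq_bigr do rewrite M_pix_starE.
(* Pixel values travel with their points, so the pixel sums cancel. *)
rewrite lerD2l /M_neig_star /M_neig.
have m_neig_starE p q : m_neig_star R s p q =
    m_neig R p q + (m_neig R p q * m_neig R (s p) (s q) - m_neig R p q ^+ 2).
  by rewrite /m_neig_star; lra.
under eq_bigr do under eq_bigr do rewrite m_neig_starE.
under eq_bigr do rewrite big_split.
(* Only the total change, the double sum of a b - a^2, remains to be bounded by 0. *)
rewrite big_split /= gerDl.
under eq_bigr do rewrite sumrB.
by rewrite sumrB subr_le0 sum_mul_perm_le_sum_sqr.
Qed.

Theorem mainTheorem1 (R : realType) (V : Type) (phi : V -> R) (n m : nat)
    (hn : (1 <= n)%N) (hm : (1 <= m)%N) (P : pixel_image V n m)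
    (p1 p2 : position n m) :
  M_total_star phi (tperm p1 p2) P <= M_total phi P.
Proof. exact: M_total_star_le. Qed.
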